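(* For every real $\alpha>\frac{1}{2}$ there exist constants $\beta,\gamma>0$ and an integer $N_0$ such that the following holds for every $n\geq N_0$. Let $G$ be a simple edge-colored graph with $n$ vertices whose edge set is partitioned into $n$ color classes $\mathcal{F}=(F_1,\ldots,F_n)$, with $\mathcal{F}=\mathcal{F}_M\cup\mathcal{F}_T\cup\mathcal{F}_S$ where every $F_i\in\mathcal{F}_M$ is a matching of size $2$, every $F_i\in\mathcal{F}_T$ is a triangle, every $F_i\in\mathcal{F}_S$ is a single edge, and $|\mathcal{F}_M\cup\mathcal{F}_T|\geq\alpha n$. Then there exists a vertex subset $H\subseteq V(G)$ with $|H|\leq\beta n$ such that the induced subgraph $G[H]$ contains a rainbow edge set of size at least $(\beta+\gamma)n$.
   Context: An edge-colored graph is a graph $G$ with a map $c:E(G)\to\mathbb{N}$; the color classes are the sets of edges of a given color. A set of edges is rainbow if its distinct edges come from distinct color classes. A matching of size $2$ is a set of two vertex-disjoint edges; a triangle is the edge set of a $3$-cycle. *)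

(* Defs.v *)
From mathcomp Require Import all_boot.

Set Implicit Arguments.
Unset Strict Implicit.
Unset Printing Implicit Defensive.

(* The vertex set is the whole of T, so the number of vertices is #|T|. *)
Record sgraph (T : finType) := SGraph {
  edges : {set {set T}};
  card_edge : forall e, e \in edges -> #|e| = 2
}.

(* A coloring is a map on all vertex sets, but only its values on the edges of
   G are ever used. The color classes are its nonempty fibers on the edges. *)
Definition color_classes (T : finType) (G : sgraph T) (c : {set T} -> nat) :
    {set {set {set T}}} :=
  preim_partition c (edges G).

Definition is_matching2 (T : finType) (F : {set {set T}}) : Prop :=
  #|F| = 2 /\ trivIset F.

Definition is_triangle (T : finType) (F : {set {set T}}) : Prop :=
  exists x y z : T, uniq [:: x; y; z] /\
    F = [set [set x; y]; [set y; z]; [set z; x]].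

Definition is_single (T : finType) (F : {set {set T}}) : Prop :=
  exists e : {set T}, F = [set e].

Definition rainbow (T : finType) (c : {set T} -> nat) (M : {set {set T}}) :
    Prop :=
  {in M &, injective c}.

Definition induced_edges (T : finType) (G : sgraph T) (H : {set T}) :
    {set {set T}} :=
  [set e in edges G | e \subset H].

(* Main.v *)
(** Delete a uniformly random set of [d = t n] vertices. A single-edge class
    loses its edge with probability at most [2 t], whereas a class that is a
    2-matching or a triangle loses all its edges only if two of its vertices
    are deleted, which has probability at most [4 t ^ 2]. So at most
    [(2 (1 - alpha) t + 4 t ^ 2) n] classes are lost on average; since
    [2 (1 - alpha) < 1], this is smaller than [t n] by a linear amount once [t]
    is small, i.e. fewer classes than vertices are lost. *)

Require Import Defs.
From mathcomp Require Import all_boot all_order all_algebra.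
From mathcomp Require Import reals zify ring lra.

Set Implicit Arguments.
Unset Strict Implicit.
Unset Printing Implicit Defensive.

Import Order.TTheory GRing.Theory Num.Theory.
Local Open Scope ring_scope.

(** For [n >= 2], a random [k]-subset of [n] points misses two given points with probability
    [(n-k)(n-k-1) / (n(n-1))], which is at most [((n-k)/n)^2]; denominators are cleared. *)
Lemma leq_mul_bin_pred2 (n k : nat) :
  (n * n * 'C(n.-2, k) <= (n - k) * (n - k) * 'C(n, k))%N.
Proof.
case: n => [|n]; first by [].
have step : (n.+1 * 'C(n.-1, k) <= (n.+1 - k) * 'C(n, k))%N.
  have [le_kn|lt_nk] := leqP k n.
    have := mul_bin_down n k; have := leq_bin2l k (leq_pred n).
    by rewrite subSn //; lia.
  by rewrite bin_small ?muln0 //; lia.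
have := mul_bin_down n.+1 k => /= E.
rewrite -!mulnA -E [X in (_ <= X)%N]mulnCA.
exact: leq_mul (leqnn _) step.
Qed.

(** * Averaging over vertex sets of a fixed size *)

Section Averaging.

Variable T : finType.
Implicit Types (A H : {set T}) (F : {set {set T}}) (k : nat).

(** Here [H] is the set of vertices kept; its complement is the deleted set. *)
Definition lost H F := [forall e in F, ~~ (e \subset H)].

Lemma card_draws_avoid A k :
  #|[set H : {set T} | (H \subset ~: A) && (#|H| == k)]| =
  'C(#|T| - #|A|, k).
Proof. by rewrite cards_draws cardsCs setCK. Qed.

(** Union bound: losing [F] deletes all of some [A] in [s], and exactly ['C(#|T| - a, k)] sets of
    size [k] avoid a given [A]. *)
Lemma card_lost_cover (s : seq {set T}) a F k :
  {in s, forall A, #|A| = a} ->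
  (forall H, lost H F -> has (fun A => H \subset ~: A) s) ->
  (#|[set H : {set T} | lost H F && (#|H| == k)]| <=
     size s * 'C(#|T| - a, k))%N.
Proof.
move=> sa cov.
apply: (@leq_trans #|\bigcup_(A <- s)
   [set H : {set T} | (H \subset ~: A) && (#|H| == k)]|).
  apply/subset_leq_card/subsetP => H; rewrite inE => /andP[/cov/hasP[A As HA] Hk].
  by rewrite (big_rem A As) /= inE inE HA Hk.
elim: s sa {cov} => [|A s IHs] sa; first by rewrite big_nil cards0.
rewrite big_cons mulSn (leq_trans (leq_card_setU _ _)) // leq_add //.
  by rewrite card_draws_avoid sa ?mem_head.
by apply: IHs => B Bs; apply: sa; rewrite inE Bs orbT.
Qed.

Lemma notsub2 (x y : T) H :
  ~~ ([set x; y] \subset H) = (x \notin H) || (y \notin H).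
Proof. by rewrite subUset !sub1set negb_and. Qed.

Lemma avoid1 (x : T) H : (H \subset ~: [set x]) = (x \notin H).
Proof. by rewrite subsetC sub1set inE. Qed.

Lemma avoid2 (x y : T) H :
  (H \subset ~: [set x; y]) = (x \notin H) && (y \notin H).
Proof. by rewrite subsetC subUset !sub1set !inE. Qed.

(** Losing [F] loses [e], hence deletes one of its two ends. *)
Lemma card_lost_edge F e k : e \in F -> #|e| = 2%N ->
  (#|[set H : {set T} | lost H F && (#|H| == k)]| <= 2 * 'C(#|T|.-1, k))%N.
Proof.
move=> eF /eqP/cards2P[x [y [_ e_xy]]].
rewrite -subn1; apply: (@card_lost_cover [:: [set x]; [set y]]) => [A|H].
  by rewrite !inE => /orP[]/eqP->; rewrite cards1.
move=> /forall_inP/(_ _ eF); rewrite e_xy notsub2 /=.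
by rewrite !avoid1 orbF.
Qed.

(** One end of each edge must be deleted, which gives four pairs; disjointness of the edges makes
    the two vertices of each pair distinct. *)
Lemma card_lost_matching2 F k :
  {in F, forall e : {set T}, #|e| = 2%N} -> is_matching2 F ->
  (#|[set H : {set T} | lost H F && (#|H| == k)]| <= 4 * 'C(#|T|.-2, k))%N.
Proof.
move=> F2 [/eqP/cards2P[e [f [ne_ef F_ef]]] /trivIsetP tI].
have eF : e \in F by rewrite F_ef !inE eqxx.
have fF : f \in F by rewrite F_ef !inE eqxx orbT.
have /disjoint_setI0 ef0 := tI _ _ eF fF ne_ef.
have /eqP/cards2P[x [y [_ e_xy]]] := F2 _ eF.
have /eqP/cards2P[z [w [_ f_zw]]] := F2 _ fF.
have ne u v : u \in e -> v \in f -> u != v.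
  move=> ue vf; apply/eqP => uv.
  by have := in_set0 u; rewrite -ef0 inE ue uv vf.
have [xe ye] : x \in e /\ y \in e by rewrite e_xy !inE !eqxx orbT.
have [zf wf] : z \in f /\ w \in f by rewrite f_zw !inE !eqxx orbT.
rewrite -subn2.
apply: (@card_lost_cover [:: [set x; z]; [set x; w]; [set y; z]; [set y; w]]).
  by move=> A; rewrite !inE => /or4P[]/eqP->; rewrite cards2 ne.
move=> H /forall_inP lH; have := lH _ eF; have := lH _ fF.
rewrite e_xy f_zw !notsub2 /= !avoid2.
by do 4![case: (_ \in H)].
Qed.

(** Two kept vertices would keep a side, so two of the three are deleted. The three pairs are
    relaxed to four to share the bound for 2-matchings. *)
Lemma card_lost_triangle F k : is_triangle F ->
  (#|[set H : {set T} | lost H F && (#|H| == k)]| <= 4 * 'C(#|T|.-2, k))%N.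
Proof.
move=> [x [y [z [+ F_xyz]]]]; rewrite /= !inE negb_or andbT.
move=> /andP[/andP[ne_xy ne_xz] ne_yz].
apply: (@leq_trans (3 * 'C(#|T|.-2, k))); last by rewrite leq_mul2r orbT.
rewrite -subn2.
apply: (@card_lost_cover [:: [set x; y]; [set y; z]; [set z; x]]).
  move=> A; rewrite !inE => /or3P[]/eqP->; rewrite cards2.
  - by rewrite ne_xy.
  - by rewrite ne_yz.
  - by rewrite eq_sym ne_xz.
move=> H /forall_inP lH.
have := lH [set x; y]; have := lH [set y; z]; have := lH [set z; x].
rewrite F_xyz !inE !eqxx !orbT => /(_ isT) + /(_ isT) + /(_ isT).
rewrite !notsub2 /= !avoid2.
by do 3![case: (_ \in H)].
Qed.

(** First-moment argument: over random [k]-sets, the mean number of lost classes is at most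
    [2 (#|P| - #|Q|) (d/n) + 4 #|Q| (d/n)^2], and some [H] does no worse. Multiplying by [n * n]
    keeps the bound in the naturals. *)
Lemma exists_few_lost (P Q : {set {set {set T}}}) k :
  (k <= #|T|)%N ->
  Q \subset P ->
  {in P, forall F, exists2 e, e \in F & #|e| = 2%N} ->
  {in Q, forall F, {in F, forall e : {set T}, #|e| = 2%N} /\
                   (is_matching2 F \/ is_triangle F)} ->
  let n := #|T| in let d := (n - k)%N in
  exists2 H : {set T}, #|H| = k &
    (n * n * #|[set F in P | lost H F]| <=
       2 * (#|P| - #|Q|) * d * n + 4 * #|Q| * d * d)%N.
Proof.
move=> le_kn sQP P2 Q2 n d.
pose B := (2 * (#|P| - #|Q|) * d * n + 4 * #|Q| * d * d)%N.
pose D := [set H : {set T} | #|H| == k].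
have cardD : #|D| = 'C(n, k) by rewrite card_draws.
have [H HD|many] := pickP [pred H in D |
    (n * n * #|[set F in P | lost H F]| <= B)%N].
  by case/andP: HD; rewrite inE => /eqP Hk le_B; exists H.
(* Pairs of a [k]-set and a class it loses are counted in two ways. *)
have double : \sum_(H in D) #|[set F in P | lost H F]| =
    \sum_(F in P) #|[set H : {set T} | lost H F && (#|H| == k)]|.
  under eq_bigr => H _ do rewrite -sum1_card.
  under [RHS]eq_bigr => F _ do rewrite -sum1_card.
  rewrite (exchange_big_dep (mem P)) /=; last by move=> H F _; rewrite inE => /andP[].
  apply: eq_bigr => F FP; apply: eq_bigl => H.
  by rewrite !inE FP andbC.
have upper : (\sum_(F in P) #|[set H : {set T} | lost H F && (#|H| == k)]|
    <= (#|P| - #|Q|) * (2 * 'C(n.-1, k)) + #|Q| * (4 * 'C(n.-2, k)))%N.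
  rewrite (big_setID Q) /= (setIidPr sQP) addnC leq_add //.
    have -> : (#|P| - #|Q| = #|P :\: Q|)%N by rewrite cardsD (setIidPr sQP).
    rewrite -sum_nat_const leq_sum // => F.
    by rewrite inE => /andP[_ /P2[e eF e2]]; apply: card_lost_edge eF e2.
  rewrite -sum_nat_const leq_sum // => F /Q2[F2 [FM|FT]].
    exact: card_lost_matching2.
  exact: card_lost_triangle.
(* If every [H] fails, each term is at least [B.+1] by integrality; the sum then exceeds
   ['C(n, k) * B], contradicting [up]. *)
have lower : (\sum_(H in D) (B.+1) <=
    \sum_(H in D) n * n * #|[set F in P | lost H F]|)%N.
  by apply: leq_sum => H HD; rewrite ltnNge; have := many H; rewrite inE HD /= => ->.
rewrite sum_nat_const cardD -big_distrr /= double in lower.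
have C0 : (0 < 'C(n, k))%N by rewrite bin_gt0.
have up : (n * n * ((#|P| - #|Q|) * (2 * 'C(n.-1, k)) +
                    #|Q| * (4 * 'C(n.-2, k))) <= 'C(n, k) * B)%N.
  rewrite /B mulnDr [X in (_ <= X)%N]mulnDr leq_add //.
    have E1 := mul_bin_down n k; rewrite -/d in E1.
    have -> : (n * n * ((#|P| - #|Q|) * (2 * 'C(n.-1, k))) =
               2 * (#|P| - #|Q|) * n * (n * 'C(n.-1, k)))%N by ring.
    by rewrite E1; apply/eq_leq; ring.
  have -> : (n * n * (#|Q| * (4 * 'C(n.-2, k))) =
             4 * #|Q| * (n * n * 'C(n.-2, k)))%N by ring.
  apply: leq_trans (leq_mul (leqnn _) (leq_mul_bin_pred2 n k)) _.
  by rewrite -/d; apply/eq_leq; ring.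
have := leq_trans lower (leq_trans (leq_mul (leqnn (n * n)) upper) up).
by rewrite mulnS -[X in (_ <= X)%N]add0n leq_add2r leqNgt C0.
Qed.

End Averaging.

(** * Rainbow sets from the surviving color classes *)

Section ColorClasses.

Variables (T : finType) (G : sgraph T) (c : {set T} -> nat).
Implicit Types (e f : {set T}) (E F : {set {set T}}).

Lemma color_class_edges F :
  F \in color_classes G c -> {subset F <= edges G}.
Proof. by case/imsetP => e _ -> f; rewrite inE => /andP[]. Qed.

Lemma color_class_neq0 F :
  F \in color_classes G c -> exists e, e \in F.
Proof. by case/imsetP => e eG ->; exists e; rewrite inE eG eqxx. Qed.

Lemma color_class_inj E F e f :
  E \in color_classes G c -> F \in color_classes G c ->
  e \in E -> f \in F -> c e = c f -> E = F.
Proof.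
case/imsetP => e0 _ -> /imsetP[f0 _ ->]; rewrite !inE.
case/andP=> _ /eqP ce /andP[_ /eqP cf] cef.
by apply/setP => g; rewrite !inE ce cef cf.
Qed.

(** One edge inside [H] is picked from each class that is not lost; distinct classes have distinct
    colors, so the picks are distinct and rainbow. *)
Lemma rainbow_selection (H : {set T}) :
  exists2 M : {set {set T}}, M \subset induced_edges G H /\ rainbow c M &
    #|M| = (#|color_classes G c| -
            #|[set F in color_classes G c | lost H F]|)%N.
Proof.
set P := color_classes G c.
(* The default [set0] is never reached on a surviving class. *)
pose rep F := odflt set0 [pick e in F | e \subset H].
have repP F : F \in P :\: [set F in P | lost H F] ->
    [/\ F \in P, rep F \in F & rep F \subset H].
  rewrite !inE => /andP[+ FP]; rewrite FP /= => /forall_inPn[e eF /negPn eH].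
  rewrite /rep; case: pickP => [f /andP[] //|/(_ e)].
  by rewrite eF eH.
exists (rep @: (P :\: [set F in P | lost H F])); first split.
- apply/subsetP => _ /imsetP[F /repP[FP eF eH] ->].
  by rewrite inE eH (color_class_edges FP).
- move=> _ _ /imsetP[E /repP[EP eE _] ->] /imsetP[F /repP[FP eF _] ->] cEF.
  by rewrite (color_class_inj EP FP eE eF cEF).
- rewrite card_in_imset ?cardsD.
    by congr (_ - _)%N; apply: eq_card => F; rewrite !inE andbA andbb.
  move=> E F /repP[EP eE _] /repP[FP eF _] eq_rep.
  by apply: (color_class_inj EP FP eE eF); rewrite eq_rep.
Qed.

End ColorClasses.

(** * Choice of the constants and the final estimate *)

Theorem theorem3p2 (R : realType) (alpha : R) (halpha : 1 / 2 < alpha) :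
  exists (beta gamma : R) (N0 : nat),
    0 < beta /\ 0 < gamma /\
    forall n : nat, (N0 <= n)%N ->
    forall (T : finType) (G : sgraph T) (c : {set T} -> nat)
      (FM FT FS : {set {set {set T}}}),
      #|T| = n ->
      #|color_classes G c| = n ->
      color_classes G c = FM :|: FT :|: FS ->
      (forall F, F \in FM -> is_matching2 F) ->
      (forall F, F \in FT -> is_triangle F) ->
      (forall F, F \in FS -> is_single F) ->
      alpha * n%:R <= #|FM :|: FT|%:R ->
      exists H : {set T},
        #|H|%:R <= beta * n%:R /\
        exists M : {set {set T}},
          M \subset induced_edges G H /\
          rainbow c M /\
          (beta + gamma) * n%:R <= #|M|%:R.
Proof.
(* This gives [2 (1 - alpha) <= 1 - eta]; the cap at 1 keeps [t] at most [1/8], whence [beta > 0]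
   and [d <= n]. *)
pose eta : R := Num.min (2 * alpha - 1) 1.
have eta0 : 0 < eta by rewrite lt_min; apply/andP; split; lra.
have eta1 : eta <= 1 by rewrite ge_min lexx orbT.
have etaA : eta <= 2 * alpha - 1 by rewrite ge_min lexx.
(* [t] maximises [eta * t - 4 * t ^ 2], the guaranteed gain per vertex; the
   maximum is [2 * delta], shared by the rounding of [d] and by [gamma]. *)
pose t := eta / 8; pose delta := eta * eta / 32.
have delta0 : 0 < delta by rewrite divr_gt0 ?mulr_gt0.
have delta_t : delta < t by rewrite /delta /t; nra.
exists (1 - (t - delta)), delta, (Num.truncn delta^-1).+1.
split; first by rewrite /t /delta in delta_t *; nra.
split=> // n lt_n T G c FM FT FS Tn Pn P_eq FMP FTP _ m_ge.
have n_delta : 1 <= delta * n%:R.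
  rewrite mulrC -ler_pdivrMr // mul1r ltW // (lt_le_trans (truncnS_gt _)) //.
  by rewrite ler_nat.
have n0 : 0 < n%:R :> R by rewrite ltr0n (leq_trans _ lt_n).
(* The successor ensures [d > (t - delta) n], so the [n - d] kept vertices number at most [beta n];
   as [delta n >= 1], still [d <= t n]. *)
pose d := (Num.truncn ((t - delta) * n%:R)).+1.
have d_gt : (t - delta) * n%:R < d%:R by apply: truncnS_gt.
have d_le : d%:R <= t * n%:R.
  have : (Num.truncn ((t - delta) * n%:R))%:R <= (t - delta) * n%:R :> R.
    by rewrite truncn_le // mulr_ge0 ?ler0n // subr_ge0 ltW.
  by rewrite /d -natr1; lra.
have le_dn : (d <= n)%N by rewrite -(ler_nat R); rewrite /t in d_le; nra.
set P := color_classes G c in Pn P_eq *.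
have sQP : FM :|: FT \subset P by rewrite P_eq subsetUl.
have P2 F : F \in P -> {in F, forall e : {set T}, #|e| = 2%N}.
  by move=> FP e eF; apply: card_edge (color_class_edges FP eF).
have [|||H Hk few] := @exists_few_lost T P (FM :|: FT) (n - d) _ sQP.
- by rewrite Tn leq_subr.
- by move=> F FP; have [e eF] := color_class_neq0 FP; exists e; rewrite ?(P2 F).
- move=> F FQ; split; first exact/P2/(subsetP sQP).
  by move: FQ; rewrite inE => /orP[/FMP|/FTP]; [left|right].
rewrite Tn Pn subKn // in few.
exists H; split; first by rewrite Hk natrB //; lra.
have [M [sMG rM] cardM] := rainbow_selection G c H.
exists M; split=> //; split=> //.
rewrite -/P Pn in cardM.
set L := #|[set F in P | lost H F]| in few cardM.
have le_mn : (#|FM :|: FT| <= n)%N by rewrite -Pn subset_leq_card.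
have le_Ln : (L <= n)%N.
  by rewrite -Pn subset_leq_card //; apply/subsetP => F; rewrite inE => /andP[].
rewrite cardM natrB //.
move: few le_mn; rewrite -(ler_nat R) -[(_ <= n)%N](ler_nat R).
set m := #|_| in m_ge * => few le_mn.
rewrite natrD !natrM natrB ?(ler_nat R) // in few; last by rewrite -(ler_nat R).
(* Insert [2 (n - m) <= (1 - eta) n], [m <= n] and [d <= t n] into [few], after scaling by [n^2]. *)
have L_le : L%:R <= ((1 - eta) * t + 4 * t * t) * n%:R.
  rewrite -(ler_pM2l (mulr_gt0 n0 n0)) (le_trans few) //.
  have h1 : 2 * (n%:R - m%:R) <= (1 - eta) * n%:R :> R by nra.
  have d0 : 0 <= d%:R :> R by rewrite ler0n.
  have h2 : 2 * (n%:R - m%:R) * d%:R <= ((1 - eta) * n%:R) * (t * n%:R) :> R.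
    by rewrite ler_pM // mulr_ge0 ?subr_ge0.
  have h3 : d%:R * d%:R <= (t * n%:R) * (t * n%:R) by rewrite ler_pM.
  have h4 : m%:R * (d%:R * d%:R) <= n%:R * ((t * n%:R) * (t * n%:R)).
    by rewrite ler_pM // mulr_ge0.
  rewrite -(ler_pM2r n0) in h2.
  lra.
(* The identity is [eta * t - 4 * t^2 = eta^2 / 16 = 2 * delta]. *)
have -> : (1 - (t - delta) + delta) * n%:R =
          n%:R - ((1 - eta) * t + 4 * t * t) * n%:R.
  by rewrite /t /delta; field.
by rewrite lerD2l lerN2.
Qed.
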